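(* Let $X$ be a locally convex Hausdorff topological vector space, $g:X\to\overline{\mathbb R}$ a proper generalized polyhedral convex function, $h:X\to\overline{\mathbb R}$ a lower semicontinuous, proper, convex function, and $C\subset X$ a nonempty generalized polyhedral convex set with $(\mathrm{dom}\,g)\cap C\ne\emptyset$. Put $f:=g-h$. Let $H$ be an arbitrary selection of $\partial h$ on $C\cap\mathrm{dom}\,\partial h$, and let $G_C$ be a selection of $\partial(g+\delta_C)^*$ on $\mathrm{dom}\,\partial(g+\delta_C)^*$ whose value $G_C(\xi)$ depends only on the set $\partial(g+\delta_C)^*(\xi)$ (constructed as described in the context). Let $\{x^k\}_{k\in\mathbb N}$ and $\{\xi^k\}_{k\in\mathbb N}$ be (infinite) sequences constructed by DCA scheme 1, i.e. $x^0\in(\mathrm{dom}\,g)\cap C$ and, for every $k\ge0$, $x^k\in C\cap\mathrm{dom}\,\partial h$, $\xi^k=H(x^k)\in\mathrm{dom}\,\partial(g+\delta_C)^*$ and $x^{k+1}=G_C(\xi^k)$. Then there exist $\bar k\in\mathbb N$ and an integer $p\ge1$ such that: (a) from the index $\bar k$, both sequences $\{x^k\}$ and $\{\xi^k\}$ are cyclic with the period $p$, i.e. $x^{k+p}=x^k$ and $\xi^{k+p}=\xi^k$ for every $k\ge\bar k$; (b) from the index $\bar k$, the value of the objective function is constant, i.e. $f(x^k)=f(x^{\bar k})$ for every $k\ge\bar k$.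
   Context: $\mathbb N$ is the set of nonnegative integers; $\overline{\mathbb R}=\mathbb R\cup\{\pm\infty\}$, with the convention $(+\infty)-(+\infty)=+\infty$. $X^*$ is the topological dual of $X$ with the weak$^*$ topology, so that its dual is $X$. $\mathrm{dom}\,\varphi=\{x\mid\varphi(x)<+\infty\}$, $\mathrm{epi}\,\varphi=\{(x,\alpha)\in X\times\mathbb R\mid x\in\mathrm{dom}\,\varphi,\ \varphi(x)\le\alpha\}$; $\varphi$ is proper if $\mathrm{dom}\,\varphi\ne\emptyset$ and $\varphi>-\infty$ everywhere. $\delta_C$ is the indicator function of $C$ ($0$ on $C$, $+\infty$ off $C$). A subset of a locally convex Hausdorff topological vector space $Z$ is generalized polyhedral convex if it has the form $\{z\in L\mid\langle z_k^*,z\rangle\le\alpha_k,\ k=1,\dots,p\}$ with $L\subset Z$ a closed affine subspace, $z_k^*\in Z^*$, $\alpha_k\in\mathbb R$. A function is generalized polyhedral convex if its epigraph is a generalized polyhedral convex set. For a proper convex $\varphi$ and $\bar x\in\mathrm{dom}\,\varphi$, $\partial\varphi(\bar x)=\{x^*\in X^*\mid\langle x^*,x-\bar x\rangle\le\varphi(x)-\varphi(\bar x)\ \forall x\in X\}$, and $\mathrm{dom}\,\partial\varphi=\{x\mid\partial\varphi(x)\ne\emptyset\}$; the same notation is used for functions on $X^*$, with subgradients in $X$. The conjugate of $\varphi:X\to\overline{\mathbb R}$ is $\varphi^*(x^* )=\sup_{x\in X}[\langle x^*,x\rangle-\varphi(x)]$, $x^*\in X^*$. Construction of $G_C$: it is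 known that, under the stated assumptions, $(g+\delta_C)^*$ is a proper generalized polyhedral convex function on $X^*$ and there are finitely many nonempty generalized polyhedral convex sets $Q_1,\dots,Q_s\subset X$ such that for every $\xi\in\mathrm{dom}(g+\delta_C)^*$ there is a unique index $\ell\in\{1,\dots,s\}$ with $\partial(g+\delta_C)^*(\xi)=Q_\ell$. One picks one element $u^\ell\in Q_\ell$ for each $\ell$, and defines $G_C:\mathrm{dom}\,\partial(g+\delta_C)^*\to X$ by $G_C(\xi)=u^\ell$ whenever $\partial(g+\delta_C)^*(\xi)=Q_\ell$. The map $H:C\cap\mathrm{dom}\,\partial h\to X^*$ is any map with $H(x)\in\partial h(x)$ for all $x$. DCA scheme 1: choose $x^0\in\mathrm{dom}(g+\delta_C)=(\mathrm{dom}\,g)\cap C$; for every $k\ge0$, if $x^k$ has been defined (and lies in the domain of $H$), take $\xi^k=H(x^k)$; if $\xi^k$ has been defined and $\xi^k\in\mathrm{dom}\,\partial(g+\delta_C)^*$, take $x^{k+1}=G_C(\xi^k)$. *)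

(* Defs.v *)
From HB Require Import structures.
From mathcomp Require Import all_boot all_order all_algebra.
From mathcomp Require Import all_classical all_reals all_analysis.

Set Implicit Arguments.
Unset Strict Implicit.
Unset Printing Implicit Defensive.

Import Order.TTheory GRing.Theory Num.Theory.
Import numFieldNormedType.Exports.

Local Open Scope classical_set_scope.
Local Open Scope ring_scope.

(* The topological dual of Z. Only its underlying set is needed below:
   subgradients of functions on the dual are taken in Z itself, which is the
   dual of [topDual Z] for the weak* topology. *)
#[short(type="topDual")]
HB.structure Definition TopDual (R : realType) (Z : tvsType R) :=
  {f of @GRing.Linear R Z R^o *:%R f & @isContinuous Z R^o f}.

Lemma topDualP (R : realType) (Z : tvsType R) (f g : topDual Z) :
  (forall z, f z = g z) -> f = g.
Proof.
case: f g => [f [fD fZ fc]] [g [gD gZ gc]] /= fg.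
have {}fg : f = g by apply/funext => z; exact: fg.
case: g / fg gD gZ gc => gD gZ gc.
case: fD gD => [fD] [gD]; case: fZ gZ => [fZ] [gZ]; case: fc gc => [fc] [gc].
by rewrite (Prop_irrelevance fD gD) (Prop_irrelevance fZ gZ)
  (Prop_irrelevance fc gc).
Qed.

Section polyhedral.
Context {R : realType}.

Definition affine_set (Z : lmodType R) (L : set Z) : Prop :=
  forall (x y : Z) (t : R), L x -> L y -> L (t *: x + (1 - t) *: y).

(* [affine_set] admits the empty set; this adds no new generalized polyhedral
   set, since set0 is also cut out of the whole space by 0 <= -1. *)
Definition gen_polyhedral_set (Z : tvsType R) (D : set Z) : Prop :=
  exists (L : set Z) (p : nat) (zs : 'I_p -> topDual Z) (a : 'I_p -> R),
    [/\ affine_set L, closed L &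
        D = [set z | L z /\ forall k, zs k z <= a k]].

Local Open Scope ereal_scope.

Definition edom (T : Type) (phi : T -> \bar R) : set T :=
  [set x | phi x < +oo].

Definition proper_fun (T : Type) (phi : T -> \bar R) : Prop :=
  edom phi !=set0 /\ forall x, -oo < phi x.

Definition epigraph (X : tvsType R) (phi : X -> \bar R) : set (X * R^o) :=
  [set z | edom phi z.1 /\ phi z.1 <= (z.2 : R)%:E].

Definition gen_polyhedral_fun (X : tvsType R) (phi : X -> \bar R) : Prop :=
  gen_polyhedral_set (epigraph phi).

Definition convex_efun (X : tvsType R) (phi : X -> \bar R) : Prop :=
  convex_set (epigraph phi).

Definition indicator (T : Type) (C : set T) (x : T) : \bar R :=
  if x \in C then 0 else +oo.

End polyhedral.

Section subdifferential.
Context {R : realType} {X : tvsType R}.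
Local Open Scope ereal_scope.

Definition conjugate (phi : X -> \bar R) (xi : topDual X) : \bar R :=
  ereal_sup (range (fun x : X => (xi x : R)%:E - phi x)).

Definition subdiff (phi : X -> \bar R) (xbar : X) : set (topDual X) :=
  [set xi | edom phi xbar /\
    forall x, (xi (x - xbar)%R : R)%:E <= phi x - phi xbar].

Definition dom_subdiff (phi : X -> \bar R) : set X :=
  [set x | subdiff phi x !=set0].

Definition subdiff_dual (psi : topDual X -> \bar R) (xibar : topDual X) :
    set X :=
  [set x | edom psi xibar /\
    forall xi : topDual X, (xi x - xibar x : R)%R%:E <= psi xi - psi xibar].

Definition dom_subdiff_dual (psi : topDual X -> \bar R) : set (topDual X) :=
  [set xi | subdiff_dual psi xi !=set0].

Definition subdiff_selection (h : X -> \bar R) (C : set X)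
    (H : X -> topDual X) : Prop :=
  forall x, (C `&` dom_subdiff h) x -> subdiff h x (H x).

(* The finitely many distinct sets Q_1, ..., Q_s are the values taken by
   [subdiff_dual psi] on its domain, and picking one u^l in each Q_l amounts
   to a selection that is a function of the value alone. *)
Definition set_determined_selection (psi : topDual X -> \bar R)
    (G : topDual X -> X) : Prop :=
  (forall xi, dom_subdiff_dual psi xi -> subdiff_dual psi xi (G xi)) /\
  (forall xi xi', dom_subdiff_dual psi xi -> dom_subdiff_dual psi xi' ->
     subdiff_dual psi xi = subdiff_dual psi xi' -> G xi = G xi').

Definition dca_scheme1 (g h : X -> \bar R) (C : set X)
    (H : X -> topDual X) (G : topDual X -> X)
    (x : nat -> X) (xi : nat -> topDual X) : Prop :=
  (edom g `&` C) (x 0%N) /\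
  forall k : nat,
    [/\ (C `&` dom_subdiff h) (x k),
        xi k = H (x k),
        dom_subdiff_dual (conjugate (g \+ indicator C)) (xi k) &
        x k.+1 = G (xi k)].

(* Dual addition on \bar R, for which (+oo) - (+oo) = +oo. *)
Definition dc_objective (g h : X -> \bar R) (x : X) : \bar R :=
  (g x - h x)%dE.

End subdifferential.

(* Main.v *)
Require Import Defs.
From mathcomp Require Import all_boot all_order all_algebra.
From mathcomp Require Import all_classical all_reals all_analysis.
From HB Require Import structures.
From mathcomp Require Import ring lra.

(** Why the sequences become periodic. Write [phi] for g restricted to C (that
is, g + delta_C) and [psi] for its conjugate; the epigraph of [phi] is again a
generalized polyhedral set, cut out of a closed affine subspace L by finitely
many inequalities A_k z <= al_k. For xi in the domain of psi, psi(xi) is the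
optimal value of the linear program that maximizes xi(x) - a over the points
(x, a) of this epigraph. Linear programming duality ([lp_duality], a
consequence of Farkas' lemma [farkas]) yields multipliers mu_k >= 0 with
xi(x) - a - psi(xi) = \sum_k mu_k (A_k (x, a) - al_k) on L.

The key observation is that the subdifferential of psi at xi only depends on
the support of such a mu ([subdiff_dual_multiplier]). Indeed, if xi' has
multipliers mu' supported in the support of mu, and zeta has multipliers nu,
then for small s > 0 the weights mu + s (nu - mu') are nonnegative, hence psi
has at xi + s (zeta - xi') at most the value
psi(xi) + s (psi(zeta) - psi(xi')); a subgradient u of psi at xi then satisfies
(zeta - xi')(u) <= psi(zeta) - psi(xi'), and zeta is arbitrary. There are
finitely many supports, so the subdifferential of psi takes finitely many
values. As x_{k+1} is a function both of x_k and of the subdifferential of psi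
at xi_k, the pigeonhole principle makes the sequence ultimately periodic.

The objective is constant along a period because it never increases. Given a
subgradient u of psi at xi, the point (u, xi(u) - psi(xi)) lies in the epigraph
of phi: [subdiff_dual_epigraph] obtains this from the separation of a point
from a closed affine subspace, hence from local convexity. Thus x_{k+1}
minimizes phi - xi_k, and xi_k is a subgradient of h at x_k, so g - h does not
increase from x_k to x_{k+1} ([dca_step_descent]); a nonincreasing periodic
sequence is constant. *)

Import Order.TTheory GRing.Theory Num.Theory.
Import numFieldNormedType.Exports.

Local Open Scope classical_set_scope.
Local Open Scope ring_scope.

Set Implicit Arguments.
Unset Strict Implicit.
Unset Printing Implicit Defensive.

(** * Farkas' lemma and linear programming duality *)

Definition linear_subspace {R : realType} {V : lmodType R} (W : set V) : Prop :=
  W 0 /\ forall (a : R) u v, W u -> W v -> W (a *: u + v).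

Section farkas.
Context {R : realType} {V : lmodType R}.
Implicit Types (W L : set V) (c f : V -> R).

Lemma scalar_at0 {f} : scalar f -> f 0 = 0.
Proof.
by move=> fl; move: (fl (-1) 0 0); rewrite scaler0 addr0 mulN1r addNr.
Qed.

Lemma scalar_scale {f} : scalar f -> forall a u, f (a *: u) = a * f u.
Proof. by move=> fl a u; rewrite -[a *: u]addr0 fl scalar_at0 // addr0. Qed.

Lemma scalar_add {f} : scalar f -> forall u v, f (u + v) = f u + f v.
Proof. by move=> fl u v; rewrite -{1}[u]scale1r fl mul1r. Qed.

(** Bartl's algebraic proof, by induction on the number of constraints, which is
why V may have infinite dimension. If the first constraint cannot be
dropped, some [e] in W satisfies the others and has c(e) > 0, hence
A_0(e) > 0; projecting along [e] onto the kernel of A_0 removes the first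
constraint. The relation on W between the projected functionals gives the one
sought, where the coefficient of A_0 is nonnegative by the choice of [e]. *)
Lemma farkas W n (A : 'I_n -> V -> R) c : linear_subspace W ->
  (forall k, scalar (A k)) -> scalar c ->
  (forall u, W u -> (forall k, A k u <= 0) -> c u <= 0) ->
  exists2 mu : 'I_n -> R, (forall k, 0 <= mu k) &
    forall u, W u -> c u = \sum_k mu k * A k u.
Proof.
move=> [W0 WD]; elim: n A c => [|n IH] A c Al cl Ac.
  exists (fun=> 0) => // u Wu; rewrite big_ord0.
  apply/le_anti; rewrite Ac //=; last by case.
  have /Ac : W (-1 *: u) by rewrite -[_ *: u]addr0; apply: WD.
  rewrite (scalar_scale cl) mulN1r oppr_le0; apply.
  by case.
pose extend (a : R) (mu : 'I_n -> R) (i : 'I_n.+1) :=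
  if unlift ord0 i is Some j then mu j else a.
have extend_ge0 a mu : 0 <= a -> (forall k, 0 <= mu k) ->
    forall i, 0 <= extend a mu i.
  by move=> a0 mu0 i; rewrite /extend; case: unliftP.
have extend_sum a mu u : \sum_k extend a mu k * A k u =
    a * A ord0 u + \sum_k mu k * A (lift ord0 k) u.
  rewrite big_ord_recl {1}/extend unlift_none; congr (_ + _).
  by apply: eq_bigr => i _; rewrite /extend liftK.
have [Ac'|] := pselect (forall u, W u ->
    (forall k, A (lift ord0 k) u <= 0) -> c u <= 0).
  have [//|mu mu0 cE] := IH (fun k => A (lift ord0 k)) c _ cl Ac'.
  exists (extend 0 mu) => [|u Wu]; first exact: extend_ge0.
  by rewrite extend_sum mul0r add0r cE.
move=> /existsNP[e /not_implyP[We /not_implyP[Ae /negP]]].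
rewrite -ltNge => ce.
have A0e : 0 < A ord0 e.
  rewrite ltNge; apply/negP => A0e.
  suff : c e <= 0 by rewrite leNgt ce.
  by apply: Ac => // k; case: (unliftP ord0 k) => [j ->|->].
pose s := (A ord0 e)^-1.
have s0 : 0 < s by rewrite invr_gt0.
pose proj f u := f u - s * f e * A ord0 u.
have projl f : scalar f -> scalar (proj f).
  by move=> fl a u v; rewrite /proj fl (Al ord0) /=; ring.
have projE f u : scalar f -> proj f u = f ((- (s * A ord0 u)) *: e + u).
  by move=> fl; rewrite fl /proj; ring.
have [k|||mu mu0 cE] := IH (fun k => proj (A (lift ord0 k))) (proj c).
- exact: projl.
- exact: projl.
- move=> u Wu Au; rewrite projE //; apply: Ac => [|k]; first exact: WD.
  case: (unliftP ord0 k) => [j ->|->]; first by rewrite -projE.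
  by rewrite -projE // /proj /s mulVf ?gt_eqF // mul1r subrr.
exists (extend (s * (c e - \sum_k mu k * A (lift ord0 k) e)) mu) => [|u Wu].
  apply: extend_ge0 => //; apply: mulr_ge0; first exact: ltW.
  rewrite subr_ge0; apply: le_trans (ltW ce).
  by apply: sumr_le0 => k _; rewrite mulr_ge0_le0.
have := cE u Wu; rewrite {1}/proj => /eqP; rewrite subr_eq => /eqP ->.
rewrite extend_sum.
have -> : \sum_k mu k * proj (A (lift ord0 k)) u =
   \sum_k mu k * A (lift ord0 k) u -
   s * A ord0 u * \sum_k mu k * A (lift ord0 k) e.
  rewrite mulr_sumr -sumrB; apply: eq_bigr => k _; rewrite /proj; ring.
ring.
Qed.

(** The direction of an affine set: sums are obtained by doubling midpoints. *)
Lemma affine_set_dir L p : affine_set L -> L p ->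
  linear_subspace [set u | L (p + u)].
Proof.
move=> La Lp.
have sc (a : R) u : L (p + u) -> L (p + a *: u).
  move=> Lu; have := La _ _ a Lu Lp; rewrite scalerDr addrAC -scalerDl.
  by rewrite subrKC scale1r.
split=> [|a u v /= Lu Lv]; first by rewrite /= addr0.
rewrite (_ : a *: u + v = 2 *: (2^-1 *: (a *: u) + 2^-1 *: v)); last first.
  by rewrite -scalerDr scalerA mulfV ?pnatr_eq0 // scale1r.
apply: (sc 2 _ _).
have := La _ _ 2^-1 (sc a _ Lu) Lv; congr (L _).
have -> : 1 - 2^-1 = 2^-1 :> R by lra.
rewrite !scalerDr addrACA -scalerDl.
by have -> : 2^-1 + 2^-1 = 1 :> R; [field|rewrite scale1r].
Qed.
End farkas.

Section lp.
Context {R : realType} {V : lmodType R}.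

(** Farkas' lemma applied to the homogenized program, whose variables are a
direction y of L and a scale t >= 0. For t > 0 a feasible (y, t) stands for the
feasible point p + y / t, and for t = 0 for a direction in which the feasible
set is unbounded, where c cannot increase as it is bounded. The slack [nu],
the multiplier of t >= 0, vanishes when [v] is the exact optimal value. *)
Lemma lp_duality (L : set V) n (A : 'I_n -> V -> R) (al : 'I_n -> R)
    (c : V -> R) (v : R) :
  affine_set L -> (forall k, scalar (A k)) -> scalar c ->
  [set z | L z /\ forall k, A k z <= al k] !=set0 ->
  (forall z, L z -> (forall k, A k z <= al k) -> c z <= v) ->
  exists (mu : 'I_n -> R) (nu : R), [/\ forall k, 0 <= mu k, 0 <= nu &
    forall z, L z -> c z - v = \sum_k mu k * (A k z - al k) - nu].
Proof.
move=> La Al cl [p [Lp Ap]] cv.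
have [W0 WD] := affine_set_dir La Lp.
pose W := [set w : V * R^o | L (p + w.1)].
have Wsub : linear_subspace W.
  by split=> //= a [u1 u2] [v1 v2]; exact: WD.
pose A' (i : 'I_n.+1) (w : V * R^o) : R :=
  if unlift ord0 i is Some k then A k w.1 + (w.2 : R) * (A k p - al k)
  else - w.2.
have [i|||mu mu0 cE] := @farkas R (V * R^o)%type W n.+1 A'
    (fun w => c w.1 + (w.2 : R) * (c p - v)) Wsub.
- rewrite /A' => a [u1 u2] [v1 v2] /=; case: unliftP => [j|] _ /=.
    rewrite (Al j) /GRing.scale /=; ring.
  by rewrite /GRing.scale /=; ring.
- by move=> a [u1 u2] [v1 v2] /=; rewrite cl /GRing.scale /=; ring.
- move=> [y t] /= Wy A'le; rewrite /W /= in Wy.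
  have t0 : 0 <= t by have := A'le ord0; rewrite /A' unlift_none oppr_le0.
  have Ale k : A k y + t * (A k p - al k) <= 0.
    by have := A'le (lift ord0 k); rewrite /A' liftK.
  have Lray (s : R) : L (p + s *: y) by rewrite -[s *: y]addr0; exact: WD.
  move: t0; rewrite le_eqVlt => /predU1P[t0|t0].
    rewrite -t0 mul0r addr0 leNgt; apply/negP => cy.
    (* A step long enough for c to exceed v. *)
    pose s := (v - c p + 1) / c y.
    have s0 : 0 <= s.
      by apply: divr_ge0; [have := cv _ Lp Ap; lra|exact: ltW].
    have Aray k : A k (p + s *: y) <= al k.
      rewrite scalar_add // scalar_scale //.
      have := Ale k; rewrite -t0 mul0r addr0 => Aky.
      by have := mulr_ge0_le0 s0 Aky; have := Ap k; lra.
    have := cv _ (Lray s) Aray; rewrite scalar_add // scalar_scale //.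
    by rewrite /s mulfVK ?gt_eqF //; lra.
  have := cv _ (Lray t^-1); rewrite scalar_add // scalar_scale // => cvt.
  have {cvt} : c p + t^-1 * c y <= v.
    apply: cvt => k; rewrite scalar_add // scalar_scale //.
    rewrite -(ler_pM2l t0) mulrDr mulVKf ?gt_eqF //.
    by have := Ale k; lra.
  by rewrite -(ler_pM2l t0) mulrDr mulVKf ?gt_eqF //; lra.
exists (fun k => mu (lift ord0 k)), (mu ord0); split=> // z Lz.
have := cE (z - p, 1) _; rewrite /W /= addrC subrK => /(_ Lz).
rewrite big_ord_recl {1}/A' unlift_none /=.
have sub f : scalar f -> f (z - p) = f z - f p.
  by move=> fl; rewrite scalar_add // -scaleN1r scalar_scale // mulN1r.
rewrite sub // => cE'.
have {cE'} : c z - v =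
  mu ord0 * -1 + \sum_(i < n) mu (lift ord0 i) * A' (lift ord0 i) (z - p, 1).
  by rewrite -cE'; ring.
move=> ->; rewrite addrC mulrN1; congr (_ - _).
by apply: eq_bigr => k _; rewrite /A' liftK /= sub //; ring.
Qed.
End lp.

(** * Separation of a point from a closed affine subspace *)

Section hahn_banach.
Context {R : realType}.

Lemma convex_set_conv (V : lmodType R) (U : set V) x y (a : R) :
  convex_set U -> 0 <= a -> a <= 1 -> U x -> U y -> U (a *: x + (1 - a) *: y).
Proof.
move=> Uconv a0 a1 Ux Uy; pose l : {i01 R} := Itv01 a0 a1.
by have := Uconv x y l (mem_set Ux) (mem_set Uy); rewrite inE.
Qed.

(** The Hahn-Banach theorem for the gauge of U, phrased without the gauge:
a linear functional is below the gauge exactly when it is at most 1 on U.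
Partial functionals are represented by their graphs, so that Zorn's lemma
applies to subspaces of V * R ordered by inclusion. The one-dimensional
extension in the direction y takes for c, the value at y, the supremum of the
lower bounds (r - 1) / t imposed by the points x - t y of U; convexity of U
bounds them by the upper bounds imposed by the points x + t y of U. *)
Lemma hahn_banach (V : lmodType R) (U : set V) (G : set (V * R^o)) :
  convex_set U -> (forall x, exists2 t : R, 0 < t & U (t *: x)) ->
  linear_subspace G -> (forall x (r : R), G (x, r) -> U x -> r <= 1) ->
  exists f : V -> R, [/\ scalar f, forall x (r : R), G (x, r) -> f x = r &
    forall x, U x -> f x <= 1].
Proof.
move=> Uconv Uabs [G0 GD] GU.
have U0 : U 0 by have [t _] := Uabs 0; rewrite scaler0.
have Uavg (s t : R) x y : 0 < s -> 0 < t -> U x -> U y ->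
    U ((s + t)^-1 *: (s *: x + t *: y)).
  move=> s0 t0 Ux Uy.
  have st0 : 0 < s + t by exact: addr_gt0.
  have a0 : 0 <= s / (s + t) by rewrite divr_ge0 ?ltW.
  have a1 : s / (s + t) <= 1 by rewrite ler_pdivrMr // mul1r lerDl ltW.
  have := convex_set_conv Uconv a0 a1 Ux Uy; congr (U _).
  rewrite scalerDr !scalerA ![(s + t)^-1 * _]mulrC.
  by congr (_ + _ *: _); field; rewrite gt_eqF.
(* The empty set is allowed because the union of the empty chain is empty. *)
pose P (A : set (V * R^o)) := [/\ A = set0 \/ G `<=` A,
  forall (a : R) u v, A u -> A v -> A (a *: u + v) &
  forall x (r : R), A (x, r) -> U x -> r <= 1].
have [F FP Ftot|A [[A0G AD AU] Amax]] := @Zorn_bigcup _ P.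
  split.
  - have [[X FX GX]|noX] := pselect (exists2 X, F X & G `<=` X).
      by right => w /GX Xw; exists X.
    left; rewrite -subset0 => w [X FX Xw].
    by have [[X0|GX] _ _] := FP _ FX; [rewrite -X0|case: noX; exists X].
  - move=> a u v [X FX Xu] [Y FY Yv].
    have [XY|YX] := Ftot _ _ FX FY.
      by exists Y => //; have [_ YD _] := FP _ FY; apply: YD => //; exact: XY.
    by exists X => //; have [_ XD _] := FP _ FX; apply: XD => //; exact: YX.
  - by move=> x r [X FX Xw] Ux; have [_ _] := FP _ FX; apply; [exact: Xw|].
have GA : G `<=` A.
  case: A0G => // A0; case: (Amax G).
    by split; rewrite A0 // => /(_ _ G0).
  by split => //; right.
have A0 : A 0 by exact: GA.
have AZ (a : R) x (r : R) : A (x, r) -> A (a *: x, a * r).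
  by move=> Axr; have := AD a _ _ Axr A0; rewrite addr0.
have Afun x (r r' : R) : A (x, r) -> A (x, r') -> r = r'.
  move=> Ar Ar'; apply/eqP; rewrite -subr_eq0; apply/negPn/negP => d0.
  have := AD (-1) _ _ Ar' Ar.
  have -> : -1 *: (x, r') + (x, r) = (0, r - r') :> V * R^o.
    by congr (_, _); rewrite scaleN1r addrC // subrr.
  move=> /(AZ (2 / (r - r'))); rewrite scaler0 mulfVK // => /AU /(_ U0).
  lra.
have Atot y : exists r : R, A (y, r).
  apply: contrapT => noy.
  pose S := [set s : R | exists x (r t : R),
    [/\ 0 < t, A (x, r), U (x - t *: y) & s = (r - 1) / t]].
  have Sub x (r t : R) : 0 < t -> A (x, r) -> U (x + t *: y) ->
      ubound S ((1 - r) / t).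
    move=> t0 Axr Uxy s [x' [r' [t' [t'0 Axr' Uxy' ->]]]].
    have /AU : A ((t + t')^-1 *: (t *: x' + t' *: x),
        (t + t')^-1 * (t * r' + t' * r)).
      exact: (AZ _ _ _ (AD t _ _ Axr' (AZ t' _ _ Axr))).
    have -> : t *: x' + t' *: x = t *: (x' - t' *: y) + t' *: (x + t *: y).
      rewrite !scalerDr scalerN !scalerA [t * t']mulrC addrACA.
      by rewrite addNr addr0.
    move=> /(_ (Uavg _ _ _ _ t0 t'0 Uxy' Uxy)).
    rewrite mulrC ler_pdivrMr ?addr_gt0 // => ineq.
    by rewrite ler_pdivrMr // mulrAC ler_pdivlMr //; lra.
  have supS : has_sup S.
    split.
      have [t t0 Uy] := Uabs (- y).
      exists ((0 - 1) / t), 0, 0, t; split=> //; rewrite add0r.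
      by rewrite -scalerN.
    have [t t0 Uy] := Uabs y; exists ((1 - 0) / t).
    by apply: (Sub 0 0) => //; rewrite add0r.
  pose c := sup S.
  pose A' := [set w : V * R^o | exists x (r t : R),
    A (x, r) /\ w = (x + t *: y, r + t * c)].
  have AA' : A `<=` A'.
    by move=> [x r] Axr; exists x, r, 0; rewrite scale0r mul0r !addr0.
  apply: (Amax A').
    split=> // A'A; apply: noy; exists c; apply: A'A.
    by exists 0, 0, 1; rewrite scale1r mul1r !add0r.
  split.
  - by right; exact: subset_trans GA AA'.
  - move=> a _ _ [x [r [t [Axr ->]]]] [x' [r' [t' [Axr' ->]]]].
    exists (a *: x + x'), (a * r + r'), (a * t + t'); split.
      exact: AD Axr Axr'.
    congr (_, _) => /=; first by rewrite scalerDr addrACA scalerA -scalerDl.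
    by rewrite /GRing.scale /=; ring.
  - move=> _ _ [x [r [t [Axr [-> ->]]]]] Uxy.
    have [t0|t0|t0] := ltgtP t 0.
    + have : (r - 1) / - t <= c.
        apply: sup_upper_bound => //; exists x, r, (- t); split=> //.
          by rewrite oppr_gt0.
        by rewrite scaleNr opprK.
      rewrite ler_pdivrMr ?oppr_gt0 //; lra.
    + have : c <= (1 - r) / t by apply: ge_sup; [case: supS|exact: Sub Uxy].
      rewrite ler_pdivlMr //; lra.
    + move: Uxy; rewrite t0 scale0r mul0r !addr0; exact: AU.
have [f fA] := choice Atot; exists f; split.
- move=> a u v; apply: (Afun (a *: u + v)) => //.
  exact: (AD a (u, _) (v, _)).
- by move=> x r /GA; exact: Afun.
- by move=> x; apply: AU.
Qed.

Lemma topDual_of_scalar (Z : tvsType R) (f : Z -> R) :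
  scalar f -> continuous (f : Z -> R^o) ->
  exists xi : topDual Z, forall z, xi z = f z.
Proof.
move=> fl fc.
pose L := GRing.isLinear.Build R Z R^o *:%R f fl.
pose C := @isContinuous.Build Z R^o f fc.
pose g := HB.pack_for (topDual Z) f L C.
by exists g.
Qed.

(** By linearity, a bound 1 on a neighbourhood U of 0 becomes a bound e on
e U. *)
Lemma continuous_of_bounded_nbhs0 (Z : tvsType R) (f : Z -> R) (U : set Z) :
  scalar f -> nbhs 0 U -> (forall z, U z -> f z <= 1) ->
  continuous (f : Z -> R^o).
Proof.
move=> fl U0 fU z; apply/cvgrPdist_le => e e0.
have near_scaled (a : R) : \forall y \near z, U (a *: (y - z)).
  have : (fun y : Z => a *: (y - z)) @ z --> a *: (z - z).
    apply: (@continuous2_cvg _ _ _ _ _ _ (fun=> a) (fun y => y - z)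
      (fun (b : R^o) (y : Z) => b *: y)).
    - exact: (@scale_continuous R Z (_,_)).
    - exact: cvg_cst.
    - apply: (@continuous2_cvg _ _ _ _ _ _ id (fun=> - z)
        (fun x y : Z => x + y)).
      + exact: (@add_continuous Z (_,_)).
      + exact: cvg_id.
      + exact: cvg_cst.
  by rewrite subrr scaler0; apply.
near=> y.
have fB (a : R) : f (a *: (y - z)) = a * (f y - f z).
  by rewrite scalar_scale // scalar_add // -scaleN1r scalar_scale // mulN1r.
have : f (e^-1 *: (y - z)) <= 1 by apply: fU; near: y; exact: near_scaled.
have : f (- e^-1 *: (y - z)) <= 1 by apply: fU; near: y; exact: near_scaled.
rewrite !fB mulNr -mulrN !ler_pdivrMl // mulr1 => h1 h2.
by rewrite distrC ler_norml; apply/andP; split; lra.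
Unshelve. all: by end_near. Qed.

(** Take a convex open neighbourhood U of 0 such that u - U misses L. The
functional d + t (u - p) |-> t on the span of the direction of L and of u - p is
at most 1 on U: a point of U where it had a value t > 1 would, divided by t,
be a point w of U with u - w in L. Its continuous extension vanishes on the
direction of L and is 1 at u - p. *)
Lemma closed_affine_separation (Z : tvsType R) (L : set Z) p u :
  affine_set L -> closed L -> L p -> ~ L u ->
  exists2 f : topDual Z, (forall z, L z -> f z = f p) & f u != f p.
Proof.
move=> La Lc Lp Lu.
have nL0 : \forall w \near (0 : Z), ~ L (u - w).
  have : (fun w : Z => u - w) @ (0 : Z) --> u - 0.
    apply: (@continuous2_cvg _ _ _ _ _ _ (fun=> u) id (fun x y : Z => x - y)).
    - exact: (@sub_continuous Z (_, _)).
    - exact: cvg_cst.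
    - exact: cvg_id.
  move=> /(_ (~` L)); apply; apply: open_nbhs_nbhs.
  by split; [exact: closed_openC|rewrite /= subr0].
have [B Bconv [Bopen Bbasis]] := @locally_convex R Z.
have [U [BU U0] UL] := Bbasis 0 _ nL0.
have nU : nbhs (0 : Z) U by apply: open_nbhs_nbhs; split=> //; exact: Bopen.
have Uconv : convex_set U by apply: Bconv; rewrite inE.
have Uabs (x : Z) : exists2 t : R, 0 < t & U (t *: x).
  have : (fun t : R^o => t *: x) @ (0 : R^o) --> 0 *: x.
    apply: (@continuous2_cvg _ _ _ _ _ _ id (fun=> x)
      (fun (b : R^o) (y : Z) => b *: y)).
    - exact: (@scale_continuous R Z (_,_)).
    - exact: cvg_id.
    - exact: cvg_cst.
  rewrite scale0r => /(_ _ nU) /nbhs_ballP[e /= e0 eU].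
  exists (e / 2); first by rewrite divr_gt0.
  apply: eU; rewrite -ball_normE /= sub0r normrN gtr0_norm ?divr_gt0 //; lra.
have [L00 LD] := affine_set_dir La Lp.
pose G := [set w : Z * R^o | L (p + (w.1 - (w.2 : R) *: (u - p)))].
have [||f [fl fG fU]] := hahn_banach Uconv Uabs (_ : linear_subspace G) _.
- split; first by rewrite /G /= scale0r subr0 addr0.
  move=> a [x r] [y s] Gx Gy; rewrite /G /= scalerDl opprD addrACA -scalerA.
  by rewrite -scalerBr; exact: LD.
- move=> x r Gx Ux; rewrite leNgt; apply/negP => r1.
  have r0 : 0 < r by apply: lt_trans r1.
  apply: (UL (r^-1 *: x)).
    have ri1 : r^-1 <= 1 by rewrite invf_le1 // ltW.
    have ri0 : 0 <= r^-1 by rewrite invr_ge0 ltW.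
    have := convex_set_conv Uconv ri0 ri1 Ux U0.
    by rewrite scaler0 addr0.
  have := LD (- r^-1) _ _ Gx L00; rewrite /= addr0 scaleNr scalerBr scalerA.
  by rewrite mulVf ?gt_eqF // scale1r opprB addrA subrKC.
have [g gf] := topDual_of_scalar fl (continuous_of_bounded_nbhs0 fl nU fU).
exists g => [z Lz|]; rewrite !gf.
  apply/eqP; rewrite -subr_eq0 -mulN1r -scalar_scale // -scalar_add // scaleN1r.
  apply/eqP/fG; by rewrite /G /= scale0r subr0 subrKC.
rewrite -subr_eq0 -mulN1r -scalar_scale // -scalar_add // scaleN1r.
rewrite (fG _ 1) ?oner_eq0 // /G /= scale1r subrr addr0 //.
Qed.
End hahn_banach.

(** * Continuous linear functionals *)

Section dual.
Context {R : realType}.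

Lemma topDual_scalar (Z : tvsType R) (f : topDual Z) : scalar f.
Proof. by move=> a u v; exact: linearP. Qed.

Lemma topDual_continuous (Z : tvsType R) (f : topDual Z) : continuous f.
Proof. exact: cts_fun. Qed.

Lemma topDual_lincomb (Z : tvsType R) (f g : Z -> R) (a b : R) :
  scalar f -> continuous (f : Z -> R^o) ->
  scalar g -> continuous (g : Z -> R^o) ->
  exists xi : topDual Z, forall z, xi z = a * f z + b * g z.
Proof.
move=> fl fc gl gc; apply: topDual_of_scalar.
  by move=> t u v; rewrite fl gl; ring.
move=> z; apply: (@cvgD R R^o); apply: cvgM;
  [exact: cvg_cst|exact: fc|exact: cvg_cst|exact: gc].
Qed.

End dual.

(** * The conjugate of a polyhedral function and its subdifferential *)

Section conjugate.
Context {R : realType} {X : tvsType R} {phi : X -> \bar R}.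
Hypothesis phi_proper : proper_fun phi.

Local Notation psi := (conjugate phi).

Lemma epigraph_fine x : edom phi x -> epigraph phi (x, fine (phi x) : R^o).
Proof.
move=> phix; split=> //=; rewrite fineK // fin_numE.
by rewrite -ltNye phi_proper.2 -ltey.
Qed.

Lemma epigraph_nonempty : epigraph phi !=set0.
Proof.
have [x /epigraph_fine phix] := phi_proper.1.
by exists (x, fine (phi x)).
Qed.

(** Together with [conjugate_le], the conjugate is the supremum of xi(x) - a
over the epigraph, a linear program when the epigraph is polyhedral. *)
Lemma conjugate_ge (xi : topDual X) x (a : R) :
  epigraph phi (x, a : R^o) -> ((xi x - a)%:E <= psi xi)%E.
Proof.
move=> [/= phix phixa].
apply: (@le_trans _ _ ((xi x : R)%:E - phi x)%E).
  by rewrite EFinB leeB.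
by apply: ereal_sup_ubound; exists x.
Qed.

Lemma conjugate_le (xi : topDual X) (v : R) :
  (forall x (a : R), epigraph phi (x, a : R^o) -> xi x - a <= v) ->
  (psi xi <= v%:E)%E.
Proof.
move=> xiv; apply: ge_ereal_sup => _ [x _ <-].
have phix := phi_proper.2 x.
have [phiy|] := boolP (phi x == +oo)%E.
  by rewrite (eqP phiy) /= leNye.
rewrite -ltey => phiy; have := xiv _ _ (epigraph_fine phiy).
by case: (phi x) phix phiy => [r| |].
Qed.

Lemma conjugate_fineK (xi : topDual X) : edom psi xi ->
  psi xi = (fine (psi xi))%:E.
Proof.
move=> xid; rewrite fineK // fin_numE -ltey andbC xid /=.
have [[x a] phix] := epigraph_nonempty.
by rewrite -ltNye; apply: lt_le_trans (conjugate_ge xi phix); exact: ltNyr.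
Qed.

Lemma conjugate_fine_ge (xi : topDual X) x (a : R) : edom psi xi ->
  epigraph phi (x, a : R^o) -> xi x - a <= fine (psi xi).
Proof.
by move=> xid phix; rewrite -lee_fin -conjugate_fineK //; exact: conjugate_ge.
Qed.

Lemma subdiff_dual_le (xi eta : topDual X) u (v : R) :
  subdiff_dual psi xi u -> (psi eta <= v%:E)%E ->
  eta u - v <= xi u - fine (psi xi).
Proof.
move=> [xid] /(_ eta) sub le.
have etad : edom psi eta by apply: le_lt_trans le _; exact: ltry.
move: sub le; rewrite (conjugate_fineK xid) (conjugate_fineK etad).
by rewrite -EFinB !lee_fin /=; lra.
Qed.

Section multipliers.
Context {L : set (X * R^o)} {n : nat}.
Context {A : 'I_n -> X * R^o -> R} {al : 'I_n -> R}.
Hypothesis L_affine : affine_set L.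
Hypothesis A_scalar : forall k, scalar (A k).
Hypothesis epiE : epigraph phi = [set z | L z /\ forall k, A k z <= al k].

(** Optimal solutions of the dual of the linear program with value psi(xi). *)
Definition multiplier (xi : topDual X) (mu : 'I_n -> R) : Prop :=
  (forall k, 0 <= mu k) /\
  forall z, L z ->
    xi z.1 - z.2 - fine (psi xi) = \sum_k mu k * (A k z - al k).

(** The slack nu given by [lp_duality] vanishes: otherwise xi(x) - a would stay
below psi(xi) - nu on the epigraph, and psi(xi) would not be its supremum. *)
Lemma ex_multiplier (xi : topDual X) : edom psi xi ->
  exists mu, multiplier xi mu.
Proof.
move=> xid.
have [||z Lz Az|mu [nu [mu0 nu0 muE]]] := @lp_duality R (X * R^o)%type L n A al
  (fun z => xi z.1 - z.2) (fine (psi xi)) L_affine A_scalar.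
- move=> a [x r] [y s] /=; rewrite topDual_scalar /GRing.scale /=; ring.
- by rewrite -epiE; exact: epigraph_nonempty.
- have : epigraph phi z by rewrite epiE.
  by case: z {Lz Az} => x a; exact: conjugate_fine_ge.
suff nuE : nu = 0.
  by exists mu; split=> // z Lz; rewrite muE // nuE subr0.
apply/le_anti; rewrite nu0 andbT.
suff : (psi xi <= (fine (psi xi) - nu)%:E)%E.
  by rewrite {1}conjugate_fineK // lee_fin; lra.
apply: conjugate_le => x a; rewrite epiE => -[Lz Az].
have := muE _ Lz; rewrite /=.
suff : \sum_k mu k * (A k (x, a) - al k) <= 0 by lra.
by apply: sumr_le0 => k _; rewrite mulr_ge0_le0 // subr_le0.
Qed.

(** Take s = 1 / (1 + \sum_k mu'_k / mu_k), as mu'_k vanishes with mu_k. *)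
Lemma ex_scale_le (mu mu' : 'I_n -> R) :
  (forall k, 0 <= mu k) -> (forall k, 0 <= mu' k) ->
  (forall k, 0 < mu' k -> 0 < mu k) ->
  exists2 s : R, 0 < s & forall k, s * mu' k <= mu k.
Proof.
move=> mu0 mu'0 supp.
have q0 k : 0 <= mu' k / mu k by rewrite divr_ge0.
have S0 : 0 <= \sum_k mu' k / mu k by apply: sumr_ge0.
exists (1 + \sum_k mu' k / mu k)^-1; first by rewrite invr_gt0; lra.
move=> k; rewrite mulrC ler_pdivrMr; last by lra.
have [muk|muk] := ltP 0 (mu k); last first.
  have -> : mu' k = 0.
    apply/le_anti; rewrite mu'0 andbT leNgt; apply/negP => /supp; lra.
  by apply: mulr_ge0 => //; lra.
rewrite mulrC -ler_pdivrMr // (bigD1 k) //=.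
suff : 0 <= \sum_(i | i != k) mu' i / mu i by lra.
by apply: sumr_ge0.
Qed.

(** Enlarging the support of the multipliers shrinks the subdifferential. Test
the subgradient inequality at xi against eta = xi + s (zeta - xi'): for s small,
mu + s (nu - mu') is nonnegative, so by weak duality psi(eta) is at most the
corresponding combination of the values at xi, zeta and xi'. *)
Lemma subdiff_dual_multiplier (xi xi' : topDual X) mu mu' :
  edom psi xi' -> multiplier xi mu -> multiplier xi' mu' ->
  (forall k, 0 < mu' k -> 0 < mu k) ->
  subdiff_dual psi xi `<=` subdiff_dual psi xi'.
Proof.
move=> xi'd [mu0 muE] [mu'0 mu'E] supp u u_sub; split=> // zeta.
have [zd|] := boolP (psi zeta < +oo)%E; last first.
  rewrite -leNgt leye_eq => /eqP ->.
  by rewrite (conjugate_fineK xi'd) /= leey.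
have [nu [nu0 nuE]] := ex_multiplier zd.
have [s s0 smu] := ex_scale_le mu0 mu'0 supp.
have [d dE] := topDual_lincomb 1 (-1) (topDual_scalar zeta)
  (@topDual_continuous _ _ _) (topDual_scalar xi') (@topDual_continuous _ _ _).
have [eta etaE] := topDual_lincomb 1 s (topDual_scalar xi)
  (@topDual_continuous _ _ _) (topDual_scalar d) (@topDual_continuous _ _ _).
have := @subdiff_dual_le xi eta u
  (fine (psi xi) + s * (fine (psi zeta) - fine (psi xi'))) u_sub.
rewrite etaE dE (conjugate_fineK xi'd) (conjugate_fineK zd) -EFinB lee_fin.
move=> step.
suff /step : (psi eta <=
    (fine (psi xi) + s * (fine (psi zeta) - fine (psi xi')))%:E)%E.
  by rewrite -(ler_pM2l s0); lra.
apply: conjugate_le => x a; rewrite epiE => -[Lz Az].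
have /= := muE _ Lz; have /= := mu'E _ Lz; have /= := nuE _ Lz.
rewrite etaE dE => nuz mu'z muz.
have : \sum_k (mu k + s * nu k - s * mu' k) * (A k (x, a) - al k) <= 0.
  apply: sumr_le0 => k _; rewrite mulr_ge0_le0 ?subr_le0 //.
  by have := smu k; have := mulr_ge0 (ltW s0) (nu0 k); lra.
rewrite (eq_bigr (fun k => mu k * (A k (x, a) - al k) +
  s * (nu k * (A k (x, a) - al k)) - s * (mu' k * (A k (x, a) - al k)))).
  rewrite sumrB big_split /= -!mulr_sumr -nuz -mu'z -muz; lra.
by move=> k _; ring.
Qed.

End multipliers.
End conjugate.

Section biconjugate.
Context {R : realType} {X : tvsType R} {phi : X -> \bar R}.
Hypothesis phi_proper : proper_fun phi.

Local Notation psi := (conjugate phi).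

(** For a subgradient u of psi at xi, the supremum of eta(u) - psi(eta) over eta
is attained at xi; this makes the point (u, xi(u) - psi(xi)) satisfy every
closed linear inequality f <= b valid on the epigraph. Adding such an inequality
to xi(x) - a <= psi(xi) bounds (xi + f(., 0))(x) - (1 - th) a on the epigraph,
where th = f(0, 1) <= 0 as epigraphs are unbounded upwards; dividing by 1 - th
gives a functional eta whose value psi(eta) is controlled. *)
Lemma subdiff_dual_halfspace (xi : topDual X) u (f : X * R^o -> R) (b : R) :
  scalar f -> continuous (f : X * R^o -> R^o) ->
  (forall z, epigraph phi z -> f z <= b) ->
  subdiff_dual psi xi u -> f (u, xi u - fine (psi xi)) <= b.
Proof.
move=> fl fc fb u_sub.
have fE x (a : R) : f (x, a : R^o) = f (x, 0) + a * f (0, 1).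
  rewrite -(scalar_scale fl) -(scalar_add fl); congr f.
  by congr (_, _) => /=; rewrite ?scaler0 ?addr0 // add0r /GRing.scale /= mulr1.
pose th := f (0, 1).
have th0 : th <= 0.
  rewrite leNgt; apply/negP => th0.
  have [[x a] epi_xa] := epigraph_nonempty phi_proper.
  pose t := (b - f (x, a) + 1) / th.
  have t0 : 0 <= t by apply: divr_ge0; [have := fb _ epi_xa; lra|exact: ltW].
  have /fb : epigraph phi (x, (a + t : R) : R^o).
    case: epi_xa => /= phix phixa; split=> //=.
    by apply: le_trans phixa _; rewrite lee_fin lerDl.
  rewrite fE mulrDl addrA -fE /t mulfVK ?gt_eqF //; lra.
pose s := (1 - th)^-1.
have th1 : 0 < 1 - th by lra.
have s0 : 0 < s by rewrite invr_gt0.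
have inl : scalar (fun x : X => f (x, 0)).
  move=> a x y; rewrite -fl; congr f; congr (_, _).
  by rewrite /= scaler0 addr0.
have inc : continuous ((fun x : X => f (x, 0)) : X -> R^o).
  move=> x; apply: (@cvg_comp _ _ _ (fun x : X => (x, 0 : R^o)) f).
  2: exact: fc.
  apply: (@cvg_pair _ _ _ _ (nbhs x) (nbhs (0 : R^o))).
    exact: cvg_id.
  exact: cvg_cst.
have [eta etaE] := topDual_lincomb s s (topDual_scalar xi)
  (@topDual_continuous _ _ _) inl inc.
have le_eta : (psi eta <= (s * (fine (psi xi) + b))%:E)%E.
  apply: conjugate_le => // x a epi_xa; rewrite etaE.
  have := conjugate_fine_ge phi_proper u_sub.1 epi_xa.
  have := fb _ epi_xa; rewrite fE -/th => h1 h2.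
  rewrite -(ler_pM2l th1) mulrBr mulrDr !mulrA mulfV ?gt_eqF // !mul1r; lra.
have := subdiff_dual_le phi_proper u_sub le_eta.
rewrite etaE -mulrDr -mulrBr ler_pdivrMl // [X in _ -> X <= _]fE -/th; lra.
Qed.

Hypothesis phi_poly : gen_polyhedral_fun phi.

(** The part of the Fenchel-Moreau theorem that the descent needs. *)
Lemma subdiff_dual_epigraph (xi : topDual X) u : subdiff_dual psi xi u ->
  epigraph phi (u, (xi u - fine (psi xi) : R) : R^o).
Proof.
move=> u_sub; have [L [n [zs [al [La Lc epiE]]]]] := phi_poly.
have epi_ne := epigraph_nonempty phi_proper.
rewrite epiE; split; last first.
  move=> k; apply: subdiff_dual_halfspace u_sub; first exact: topDual_scalar.
    exact: topDual_continuous.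
  by move=> z; rewrite epiE => -[].
apply: contrapT => nLu.
move: epi_ne; rewrite epiE => -[p [Lp _]].
have [f fL /negP] := closed_affine_separation La Lc Lp nLu; apply.
have fconst z : epigraph phi z -> f z = f p by rewrite epiE => -[/fL].
have fl := topDual_scalar f; have fc := @topDual_continuous _ _ f.
apply/eqP/le_anti/andP; split.
  by apply: subdiff_dual_halfspace u_sub => // z /fconst ->.
rewrite -lerN2.
apply: (@subdiff_dual_halfspace _ _ (fun z => - f z)) u_sub => //.
- by move=> a z w; rewrite fl; ring.
- by move=> z; apply: (@cvgN R R^o); exact: fc.
- by move=> z /fconst ->.
Qed.

(** The codes are the supports of multipliers; a point may have several. *)
Lemma finite_subdiff_dual :
  exists (T : finType) (code : topDual X -> T -> Prop),
  (forall xi, edom psi xi -> exists t, code xi t) /\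
  forall xi xi' t, edom psi xi -> edom psi xi' -> code xi t -> code xi' t ->
    subdiff_dual psi xi = subdiff_dual psi xi'.
Proof.
have [L [n [zs [al [La Lc epiE]]]]] := phi_poly.
have As k := topDual_scalar (zs k).
pose supp (mu : 'I_n -> R) := [set k | 0 < mu k]%SET.
exists {set 'I_n}, (fun xi S => exists2 mu,
  multiplier (phi := phi) (L := L) (A := zs) (al := al) xi mu & S = supp mu).
split.
  move=> xi xid; have [mu muP] := ex_multiplier phi_proper La As epiE xid.
  by exists (supp mu), mu.
move=> xi xi' S xid xi'd [mu muP SE] [mu' mu'P SE'].
have suppE k : (0 < mu k) = (0 < mu' k).
  by have /setP /(_ k) : supp mu = supp mu' by [rewrite -SE]; rewrite !inE.
apply/seteqP; split.
  by apply: (subdiff_dual_multiplier phi_proper La As epiE _ muP mu'P) => //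
    k; rewrite suppE.
by apply: (subdiff_dual_multiplier phi_proper La As epiE _ mu'P muP) => //
  k; rewrite suppE.
Qed.

End biconjugate.

(** * Restriction of a polyhedral function to a polyhedral set *)

Section restriction.
Context {R : realType} {X : tvsType R} {g : X -> \bar R} {C : set X}.
Hypothesis g_proper : proper_fun g.

Lemma edom_restriction : edom (g \+ indicator C)%E = edom g `&` C.
Proof.
apply/seteqP; split=> x; rewrite /edom /= /indicator;
  case: (boolP (x \in C)) => [/set_mem Cx|/negP nCx].
- by rewrite adde0.
- by have := g_proper.2 x; case: (g x) => [r| |] //; rewrite ?addye.
- by rewrite adde0 => -[].
- by move=> [_ Cx]; case: nCx; exact: mem_set.
Qed.

Lemma restrictionE x : C x -> (g \+ indicator C)%E x = g x.
Proof. by move=> Cx; rewrite /= /indicator mem_set // adde0. Qed.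

Lemma proper_restriction : edom g `&` C !=set0 ->
  proper_fun (g \+ indicator C)%E.
Proof.
move=> gC; split; first by rewrite edom_restriction.
move=> x; rewrite /= /indicator; have := g_proper.2 x.
by case: ifP; rewrite ?adde0 //; case: (g x) => [r| |] //; rewrite addye.
Qed.

Lemma gen_polyhedral_restriction : gen_polyhedral_fun g ->
  gen_polyhedral_set C -> gen_polyhedral_fun (g \+ indicator C)%E.
Proof.
move=> [L [n [zs [al [La Lc epiE]]]]] [M [m [ws [be [Ma Mc CE]]]]].
have /choice[vs vsE] (k : 'I_m) : exists v : topDual (X * R^o)%type,
    forall z, v z = ws k z.1.
  apply: topDual_of_scalar => [a z w|z]; first exact: topDual_scalar.
  apply: (@cvg_comp _ _ _ fst (ws k : X -> R^o)); first exact: cvg_fst.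
  exact: topDual_continuous.
exists (L `&` fst @^-1` M), (n + m)%N,
  (fun k => match fintype.split k with inl i => zs i | inr j => vs j end),
  (fun k => match fintype.split k with inl i => al i | inr j => be j end).
split.
- move=> z w t [Lz Mz] [Lw Mw]; split; first exact: La.
  exact: Ma.
- apply: closedI => //; apply: closed_comp => // z _; exact: cvg_fst.
- apply/seteqP; split=> z.
    move=> [/= + +]; rewrite -/(edom _ _) edom_restriction => -[gz Cz].
    rewrite -/((g \+ indicator C)%E z.1) restrictionE // => gza.
    have : epigraph g z by [].
    move: Cz; rewrite epiE CE => -[Mz wz] [Lz zz]; split=> // k.
    by case: splitP => j _; rewrite ?vsE.
  move=> [[Lz Mz] zz].
  have Cz : C z.1.
    rewrite CE; split=> // j; have := zz (rshift n j).
    by rewrite (unsplitK (inr j)) vsE.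
  have [gz gza] : epigraph g z.
    rewrite epiE; split=> // i; have := zz (lshift m i).
    by rewrite (unsplitK (inl i)).
  split; first by rewrite edom_restriction.
  by rewrite restrictionE.
Qed.

End restriction.

(** * Periodicity and descent *)

(** Pigeonhole on the finitely many values of S gives one repetition x_i = x_j,
which determinism propagates. *)
Lemma deterministic_ultimately_periodic (T : Type) (F : finType)
    (x : nat -> T) (S : nat -> F) :
  (forall i j, x i = x j -> x i.+1 = x j.+1) ->
  (forall i j, S i = S j -> x i.+1 = x j.+1) ->
  exists kbar p : nat,
    (1 <= p)%N /\ forall k, (kbar <= k)%N -> x (k + p)%N = x k.
Proof.
move=> x_next S_next.
have /injectivePn[i [j ij Sij]] : ~~ injectiveb (fun i : 'I_#|F|.+1 => S i).
  apply/negP => /injectiveP /leq_card; by rewrite card_ord ltnn.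
wlog : i j ij Sij / (i < j)%N.
  move=> th; have [lt|lt|/val_inj eq] := ltngtP i j; first exact: th ij Sij lt.
    by apply: th (esym Sij) lt; rewrite eq_sym.
  by rewrite eq eqxx in ij.
move=> lt_ij; exists i.+1, (j - i)%N; split; first by rewrite subn_gt0.
move=> k /subnK <-; elim: (k - i.+1)%N => [|d IH].
  by rewrite add0n addSn subnKC ?(ltnW lt_ij) //; apply/esym/S_next.
by rewrite !addSn; apply: x_next; exact: IH.
Qed.

Lemma nonincreasing_periodic_const (R : realType) (F : nat -> R) kbar p :
  (forall k, F k.+1 <= F k) -> (1 <= p)%N ->
  (forall k, (kbar <= k)%N -> F (k + p)%N = F k) ->
  forall k, (kbar <= k)%N -> F k = F kbar.
Proof.
move=> Fdec p0 Fper k kk.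
have Fmono i d : F (i + d)%N <= F i.
  by elim: d => [|d IH]; rewrite ?addn0 // addnS; apply: le_trans IH.
have Fmult m : F (kbar + m * p)%N = F kbar.
  elim: m => [|m IH]; first by rewrite addn0.
  by rewrite mulSn [(p + _)%N]addnC addnA Fper ?leq_addr.
apply/le_anti/andP; split; first by rewrite -(subnKC kk).
rewrite -(Fmult k).
have le : (k <= kbar + k * p)%N.
  by rewrite (leq_trans (leq_pmulr k p0)) ?leq_addl.
by rewrite -(subnKC le).
Qed.

Lemma dom_subdiff_fin_num (R : realType) (X : tvsType R) (h : X -> \bar R) x :
  proper_fun h -> dom_subdiff h x -> h x \is a fin_num.
Proof. by move=> [_ h_gt] [xi [hx _]]; rewrite fin_numE -ltNye -ltey h_gt. Qed.

(** The next iterate y minimizes phi - xi, so phi(y) - phi(x) <= xi(y - x), and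
xi(y - x) <= h(y) - h(x) since xi is a subgradient of h at x. *)
Lemma dca_step_descent (R : realType) (X : tvsType R) (phi h : X -> \bar R)
    (xi : topDual X) x y :
  proper_fun phi -> gen_polyhedral_fun phi -> proper_fun h ->
  edom phi x -> subdiff h x xi -> subdiff_dual (conjugate phi) xi y ->
  dom_subdiff h y ->
  edom phi y /\ fine (phi y) - fine (h y) <= fine (phi x) - fine (h x).
Proof.
move=> phi_proper phi_poly h_proper phix xi_sub y_sub hy.
have [/= phiy le_y] := subdiff_dual_epigraph phi_proper phi_poly y_sub.
split=> //.
have le_x := conjugate_fine_ge phi_proper y_sub.1
  (epigraph_fine phi_proper phix).
have hx : h x \is a fin_num by apply: dom_subdiff_fin_num => //; exists xi.
have := xi_sub.2 y; rewrite -(fineK hx)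
  -(fineK (dom_subdiff_fin_num h_proper hy)).
rewrite -EFinB lee_fin => le_h.
have [_ /= ] := epigraph_fine phi_proper phiy.
have phiyE : phi y = (fine (phi y))%:E.
  by rewrite fineK // fin_numE -ltNye phi_proper.2 -ltey.
move: le_y; rewrite phiyE lee_fin => le_y _ /=.
have xiB : xi (y - x) = xi y - xi x :> R by rewrite linearB.
by rewrite xiB in le_h; lra.
Qed.

Theorem theorem5p5 (R : realType) (X : tvsType R) (hX : hausdorff_space X)
    (g h : X -> \bar R) (C : set X)
    (g_proper : proper_fun g) (g_poly : gen_polyhedral_fun g)
    (h_lsc : lower_semicontinuous h) (h_proper : proper_fun h)
    (h_convex : convex_efun h)
    (C_nonempty : C !=set0) (C_poly : gen_polyhedral_set C)
    (gC_nonempty : (edom g `&` C) !=set0)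
    (H : X -> topDual X) (H_sel : subdiff_selection h C H)
    (G : topDual X -> X)
    (G_sel : set_determined_selection (conjugate (g \+ indicator C)%E) G)
    (x : nat -> X) (xi : nat -> topDual X)
    (x_dca : dca_scheme1 g h C H G x xi) :
  exists kbar p : nat,
    [/\ (1 <= p)%N,
        forall k : nat, (kbar <= k)%N ->
          x (k + p)%N = x k /\ xi (k + p)%N = xi k &
        forall k : nat, (kbar <= k)%N ->
          dc_objective g h (x k) = dc_objective g h (x kbar)].
Proof.
pose phi := (g \+ indicator C)%E.
have phi_proper : proper_fun phi by exact: proper_restriction.
have phi_poly : gen_polyhedral_fun phi by exact: gen_polyhedral_restriction.
have [x0 /all_and4[Cx xiE xi_dom xS]] := x_dca.
have [G_mem G_eq] := G_sel.
have y_sub k : subdiff_dual (conjugate phi) (xi k) (x k.+1).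
  by rewrite xS; exact: G_mem.
have [T [code [code_ex code_eq]]] := finite_subdiff_dual phi_proper phi_poly.
have /choice[S SP] k : exists t, code (xi k) t by exact: code_ex (y_sub k).1.
have [||kbar [p [p0 x_per]]] := @deterministic_ultimately_periodic X T x S.
- by move=> i j xij; rewrite !xS !xiE xij.
- move=> i j Sij; rewrite !xS; apply: G_eq => //.
  by apply: code_eq (SP i) _; rewrite ?Sij;
    [exact: (y_sub i).1|exact: (y_sub j).1|exact: SP].
exists kbar, p; split=> // [k kk|]; first by rewrite !xiE x_per.
have xi_sub k : subdiff h (x k) (xi k) by rewrite xiE; exact: H_sel.
have descent k (xk : edom phi (x k)) :=
  dca_step_descent phi_proper phi_poly h_proper xk (xi_sub k)
  (y_sub k) (Cx k.+1).2.
have phix k : edom phi (x k).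
  elim: k => [|k IH]; first by rewrite edom_restriction.
  exact: (descent k IH).1.
have fE k : dc_objective g h (x k) = (fine (phi (x k)) - fine (h (x k)))%:E.
  rewrite /dc_objective /phi restrictionE; last exact: (Cx k).1.
  rewrite -(fineK (dom_subdiff_fin_num h_proper (Cx k).2)) /=.
  have := phix k; rewrite edom_restriction // => -[gx _].
  by rewrite -[g (x k) in LHS]fineK // fin_numE -ltNye g_proper.2 -ltey.
move=> k kk; rewrite !fE; congr EFin.
apply: (@nonincreasing_periodic_const _
  (fun k => fine (phi (x k)) - fine (h (x k))) kbar p) => //.
- by move=> i; exact: (descent i (phix i)).2.
- by move=> i ki; rewrite x_per.
Qed.
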